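(* Let ${\rm Br}({\rm G}_2)$, ${\rm Br}({\rm D}_4)$ and ${\rm SBr}({\rm D}_4)$ be as in the context. There is an algebra isomorphism $$\phi:\ {\rm Br}({\rm G}_2)\longrightarrow {\rm SBr}({\rm D}_4)$$ determined by $\phi(r_0)=R_1R_2R_4$, $\phi(r_1)=R_3$, $\phi(e_0)=E_1E_2E_4$ and $\phi(e_1)=E_3$. Furthermore, both ${\rm Br}({\rm G}_2)$ and ${\rm SBr}({\rm D}_4)$ are free $\mathbb{Z}[\delta^{\pm1}]$-modules of rank $39$.
   Context: Let $\delta$ be an indeterminate. ${\rm Br}({\rm G}_2)$ is the $\mathbb{Z}[\delta^{\pm1}]$-algebra generated by $r_0,r_1,e_0,e_1$ subject to the following relations: - $r_0^2=r_1^2=1$; - $r_ie_i=e_ir_i=e_i$ for $i=0,1$; - $e_0^2=\delta^3e_0$ and $e_1^2=\delta e_1$; - $r_0e_1e_0=r_1e_0$ and $e_0e_1r_0=e_0r_1$; - $e_1r_0e_1r_0e_1=e_1$ and $e_1r_0e_1r_0r_1=e_1r_0r_1r_0$; - $e_0r_1e_0=\delta^2e_0$; - $r_1r_0e_1r_0e_1=r_0r_1r_0e_1$; - $(r_1r_0)^6=1$. ${\rm Br}({\rm D}_4)$ is the $\mathbb{Z}[\delta^{\pm1}]$-algebra generated by $R_i,E_i$ for $i\in\{1,2,3,4\}$. Here node $3$ is adjacent to each of $1,2,4$, and there are no other adjacencies. Write $i\sim j$ for adjacency. The relations are: - $R_i^2=1$, $E_i^2=\delta E_i$ and $R_iE_i=E_iR_i=E_i$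 for all $i$; - for $i\not\sim j$ (with $i\neq j$): $R_iR_j=R_jR_i$, $E_iR_j=R_jE_i$ and $E_iE_j=E_jE_i$; - for $i\sim j$: $R_iR_jR_i=R_jR_iR_j$, $R_jR_iE_j=E_iE_j$ and $R_iE_jR_i=R_jE_iR_j$. Let ${\rm BrM}({\rm D}_4)$ be the submonoid of the multiplicative monoid of ${\rm Br}({\rm D}_4)$ generated by $\delta^{\pm1}$ and all $R_i,E_i$. Let $\sigma$ be the algebra automorphism of ${\rm Br}({\rm D}_4)$ given by $R_i\mapsto R_{\sigma(i)}$ and $E_i\mapsto E_{\sigma(i)}$, where $\sigma$ is the permutation $(1,2,4)$ of the nodes (fixing $3$). ${\rm SBr}({\rm D}_4)$ denotes the subalgebra of ${\rm Br}({\rm D}_4)$ generated by the $\sigma$-invariant elements of ${\rm BrM}({\rm D}_4)$. *)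

(* Defs.v *)
From HB Require Import structures.
From mathcomp Require Import all_boot all_order all_algebra.
Set Implicit Arguments.
Unset Strict Implicit.
Unset Printing Implicit Defensive.
Import GRing.Theory.
Local Open Scope ring_scope.

(* The coefficient ring Z[delta^{+-1}], characterised by its universal   *)
(* property: d is a unit of L, and for every commutative ring S with a    *)
(* unit u there is exactly one ring morphism L -> S sending d to u.       *)
Definition laurent_ring (L : comUnitRingType) (d : L) : Prop :=
  d \is a GRing.unit /\
  forall (S : comUnitRingType) (u : S), u \is a GRing.unit ->
    (exists f : {rmorphism L -> S}, f d = u) /\
    (forall f g : {rmorphism L -> S}, f d = u -> g d = u -> f =1 g).

Definition BrG2_rel (L : comUnitRingType) (d : L) (A : algType L)
    (r0 r1 e0 e1 : A) : Prop :=
  [/\ [/\ r0 * r0 = 1, r1 * r1 = 1,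
          r0 * e0 = e0, e0 * r0 = e0 & r1 * e1 = e1],
      [/\ e1 * r1 = e1, e0 * e0 = (d ^+ 3) *: e0, e1 * e1 = d *: e1,
          r0 * e1 * e0 = r1 * e0 & e0 * e1 * r0 = e0 * r1] &
      [/\ e1 * r0 * e1 * r0 * e1 = e1,
          e1 * r0 * e1 * r0 * r1 = e1 * r0 * r1 * r0,
          e0 * r1 * e0 = (d ^+ 2) *: e0,
          r1 * r0 * e1 * r0 * e1 = r0 * r1 * r0 * e1 &
          (r1 * r0) ^+ 6 = 1]].

Definition is_BrG2 (L : comUnitRingType) (d : L) (A : algType L)
    (r0 r1 e0 e1 : A) : Prop :=
  BrG2_rel d r0 r1 e0 e1 /\
  forall (B : algType L) (s0 s1 f0 f1 : B), BrG2_rel d s0 s1 f0 f1 ->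
    (exists phi : {lrmorphism A -> B},
        [/\ phi r0 = s0, phi r1 = s1, phi e0 = f0 & phi e1 = f1]) /\
    (forall phi psi : {lrmorphism A -> B},
        phi r0 = psi r0 -> phi r1 = psi r1 -> phi e0 = psi e0 ->
        phi e1 = psi e1 -> phi =1 psi).

(* Br(D4): nodes 1,2,3,4; node 3 adjacent to 1,2,4, no other adjacency. *)
(* Generators are given as functions R E : nat -> B, only their values  *)
(* on the nodes 1..4 matter.                                             *)
Definition D4nodes : seq nat := [:: 1%N; 2%N; 3%N; 4%N].

Definition D4adj (i j : nat) : bool :=
  ((i == 3%N) && (j \in [:: 1%N; 2%N; 4%N])) ||
  ((j == 3%N) && (i \in [:: 1%N; 2%N; 4%N])).

Definition BrD4_rel (L : comUnitRingType) (d : L) (B : algType L)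
    (R E : nat -> B) : Prop :=
  (forall i, i \in D4nodes ->
     [/\ R i * R i = 1, E i * E i = d *: E i,
         R i * E i = E i & E i * R i = E i]) /\
  (forall i j, i \in D4nodes -> j \in D4nodes -> i != j -> ~~ D4adj i j ->
     [/\ R i * R j = R j * R i, E i * R j = R j * E i &
         E i * E j = E j * E i]) /\
  (forall i j, i \in D4nodes -> j \in D4nodes -> D4adj i j ->
     [/\ R i * R j * R i = R j * R i * R j, R j * R i * E j = E i * E j &
         R i * E j * R i = R j * E i * R j]).

Definition is_BrD4 (L : comUnitRingType) (d : L) (B : algType L)
    (R E : nat -> B) : Prop :=
  BrD4_rel d R E /\
  forall (C : algType L) (R' E' : nat -> C), BrD4_rel d R' E' ->
    (exists phi : {lrmorphism B -> C},
        forall i, i \in D4nodes -> phi (R i) = R' i /\ phi (E i) = E' i) /\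
    (forall phi psi : {lrmorphism B -> C},
        (forall i, i \in D4nodes ->
           phi (R i) = psi (R i) /\ phi (E i) = psi (E i)) ->
        phi =1 psi).

Definition sigmaD4 (i : nat) : nat :=
  if i == 1%N then 2%N else if i == 2%N then 4%N
  else if i == 4%N then 1%N else i.

Inductive inBrM (L : comUnitRingType) (d : L) (B : algType L)
    (R E : nat -> B) : B -> Prop :=
  | BrM_one : inBrM d R E 1
  | BrM_d : inBrM d R E (d%:A)
  | BrM_dinv : inBrM d R E ((d^-1)%:A)
  | BrM_R i : i \in D4nodes -> inBrM d R E (R i)
  | BrM_E i : i \in D4nodes -> inBrM d R E (E i)
  | BrM_mul x y : inBrM d R E x -> inBrM d R E y -> inBrM d R E (x * y).

(* SBr(D4): the subalgebra of B generated by the sigma-invariant elements *)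
(* of BrM(D4); here s is the algebra automorphism induced by sigma.      *)
Inductive inSBr (L : comUnitRingType) (d : L) (B : algType L)
    (R E : nat -> B) (s : B -> B) : B -> Prop :=
  | SBr_gen x : inBrM d R E x -> s x = x -> inSBr d R E s x
  | SBr_zero : inSBr d R E s 0
  | SBr_one : inSBr d R E s 1
  | SBr_add x y : inSBr d R E s x -> inSBr d R E s y -> inSBr d R E s (x + y)
  | SBr_scale (a : L) x : inSBr d R E s x -> inSBr d R E s (a *: x)
  | SBr_mul x y : inSBr d R E s x -> inSBr d R E s y -> inSBr d R E s (x * y).

(* Main.v *)
(** Both algebras are monomial: every defining relation has the form [u = d^k v]
    for words [u], [v] in the generators. Knuth-Bendix completion with the
    shortlex order turns the relations of Br(D4) into a rewriting system with
    1569 irreducible words, and those of Br(G2) into one with 39.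

    Soundness of rewriting shows that every monomial of Br(D4) is a power of [d]
    times an irreducible word. The right multiplication table of the irreducible
    words defines monomial matrices that satisfy the relations of Br(D4); in this
    regular representation distinct irreducible words move the first basis vector
    to unit multiples of distinct basis vectors, so they are linearly independent
    in Br(D4). Hence a monomial is sigma-invariant exactly when its irreducible
    word [w] and that of [sigma w] coincide. The 39 irreducible words of Br(G2) span Br(G2), and their images
    are, up to powers of [d], distinct irreducible words which exhaust the
    sigma-invariant ones. *)

Require Import Defs.
From Stdlib Require Import PArith FMapPositive.
From HB Require Import structures.
From mathcomp Require Import all_boot all_order all_algebra boolp.
Import GRing.Theory.

Set Implicit Arguments.
Unset Strict Implicit.
Unset Printing Implicit Defensive.

(** * Rewriting of words with rules stored in a trie *)

Notation word := (seq nat).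

(* A rewriting system is stored as a trie: the path from the root to a rule
   [(k, r)] spells its left-hand side [l] backwards, and the rule reads
   [l = d^k r]. *)
Inductive trie := Trie of option (nat * word) & seq trie.
Definition trie0 := Trie None [::].

Fixpoint tinsert (l : word) (r : nat * word) (t : trie) : trie :=
  let: Trie o ch := t in
  if l is a :: l' then Trie o (set_nth trie0 ch a (tinsert l' r (nth trie0 ch a)))
  else Trie (Some r) ch.

Fixpoint tfind (t : trie) (s : word) : option ((nat * word) * word) :=
  let: Trie o ch := t in
  if o is Some r then Some (r, s) else
  if s is a :: s' then tfind (nth trie0 ch a) s' else None.

(* Normalises [rev s ++ w], where the stack [s] is the part already reduced. *)
Fixpoint rewr (fuel : nat) (t : trie) (k : nat) (s w : word) : nat * word :=
  match fuel, w with
  | n.+1, a :: w' =>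
      if tfind t (a :: s) is Some ((k', r), s') then rewr n t (k' + k) s' (r ++ w')
      else rewr n t k (a :: s) w'
  | _, _ => (k, catrev s w)
  end.

(** When the fuel 300 runs out, the current word is returned; it still represents the same element,
    so soundness holds for any amount of fuel. *)
Definition norm t w := rewr 300 t 0 [::] w.

(** * Knuth-Bendix completion in the shortlex order *)

Fixpoint eqw (u v : word) : bool :=
  match u, v with
  | [::], [::] => true
  | a :: u', b :: v' => eqn a b && eqw u' v'
  | _, _ => false
  end.

Fixpoint lexlt (u v : word) : bool :=
  match u, v with
  | a :: u', b :: v' => (a < b) || eqn a b && lexlt u' v'
  | _, _ => false
  end.
Definition shortlex u v := (size u < size v) || (size u == size v) && lexlt u v.

(* An equation whose rule would need a negative power of [d] is dropped. *)
Definition orient (x y : nat * word) : option (word * (nat * word)) :=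
  let: (k, u) := x in let: (l, v) := y in
  if eqw u v then None else
  if shortlex v u then if k <= l then Some (u, (l - k, v)) else None
  else if l <= k then Some (v, (k - l, u)) else None.

Definition relation := (word * (nat * word))%type.

Definition of_relation t (e : relation) :=
  let: (u, (k, v)) := e in let: (l, v') := norm t v in orient (norm t u) (k + l, v').

(* The two ways of reducing [x ++ y], with and without reducing [y] first, give
   an equation that is valid for all words [x] and [y]; it resolves a critical
   pair when [y] is a left-hand side and a prefix of [x ++ y] is another one. *)
Definition superpose t (xy : word * word) :=
  let: (x, y) := xy in
  let: (k, y') := norm t y in let: (l, v) := norm t (x ++ y') in
  orient (norm t (x ++ y)) (k + l, v).

Definition add_rule t (o : option relation) :=
  if o is Some (l, r) then tinsert (rev l) r t else t.

(* Completion is only used to find the list of superpositions to perform; its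
   output is trusted because replaying any such list is sound. *)
Definition replay (rels : seq relation) (cert : seq (word * word)) : trie :=
  foldl (fun t xy => add_rule t (superpose t xy))
    (foldl (fun t e => add_rule t (of_relation t e)) trie0 rels) cert.

(** A pair [(x, v)] encodes the overlap word [x ++ v], which has [u] as a prefix: this is the input
    that [superpose] expects. *)
Definition overlaps (u v : word) : seq (word * word) :=
  [seq (take (size u - i) u, v) | i <- iota 1 (minn (size u) (size v)).-1
    & eqw (drop (size u - i) u) (take i v)].

(* Pending critical pairs are queued by the length of the overlap word. *)
Record kb := KB { kb_trie : trie; kb_lhs : seq word;
  kb_queue : seq (seq (word * word)); kb_cert : seq (word * word) }.

Definition kb_add (c : option (word * word)) (o : option relation) (s : kb) : kb :=
  if o is Some (l, r) then
    let ls := l :: kb_lhs s in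
    let enq q xy := let n := size xy.1 + size xy.2 in
       set_nth [::] q n (xy :: nth [::] q n) in
    KB (tinsert (rev l) r (kb_trie s)) ls
      (foldl enq (kb_queue s)
         (flatten [seq overlaps l l' ++ overlaps l' l | l' <- ls]))
      (* Only superpositions that produced a rule are recorded; rules from the initial relations
         ([c = None]) are rebuilt by [replay] itself. *)
      (if c is Some xy then xy :: kb_cert s else kb_cert s)
  else s.

Fixpoint dequeue T (q : seq (seq T)) : option (T * seq (seq T)) :=
  match q with
  | [::] => None
  | (x :: b) :: q' => Some (x, b :: q')
  | [::] :: q' => if dequeue q' is Some (x, q'') then Some (x, [::] :: q'') else None
  end.

Definition kb_step (s : kb) : kb :=
  if dequeue (kb_queue s) is Some (xy, q) then
    kb_add (Some xy) (superpose (kb_trie s) xy)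
      (KB (kb_trie s) (kb_lhs s) q (kb_cert s))
  else s.

Definition kb_init (rels : seq relation) : kb :=
  foldl (fun s e => kb_add None (of_relation (kb_trie s) e) s)
    (KB trie0 [::] [::] [::]) rels.

(** The 90000 steps are an upper bound: [kb_step] is the identity once the queue is empty. *)
Definition completion (rels : seq relation) : seq (word * word) :=
  rev (kb_cert (iter 300 (iter 300 kb_step) (kb_init rels))).

(** * Words acting on states, and the two presentations *)

Fixpoint run X (act : nat -> X -> nat * X) (u : word) (k : nat) (x : X) : nat * X :=
  if u is g :: u' then let: (l, y) := act g x in run act u' (l + k) y else (k, x).

Lemma run_preserves X (act : nat -> X -> nat * X) (P : X -> bool) :
  (forall g x, P x -> P (act g x).2) ->
  forall u k x, P x -> P (run act u k x).2.
Proof.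
move=> actP; elim=> //= g u IHu k x /(actP g).
by case: (act g x) => l y; apply: IHu.
Qed.

(* The letter [i] stands for R_i and the letter [4 + i] for E_i. *)
Definition D4rels : seq relation :=
  flatten [seq [:: ([:: i; i], (0, [::])); ([:: 4 + i; 4 + i], (1, [:: 4 + i]));
       ([:: i; 4 + i], (0, [:: 4 + i])); ([:: 4 + i; i], (0, [:: 4 + i]))]
    | i <- D4nodes]
  ++ flatten [seq
      if i == j then [::] else
      if D4adj i j then
        [:: ([:: i; j; i], (0, [:: j; i; j])); ([:: j; i; 4 + j], (0, [:: 4 + i; 4 + j]));
            ([:: i; 4 + j; i], (0, [:: j; 4 + i; j]))]
      else [:: ([:: i; j], (0, [:: j; i])); ([:: 4 + i; j], (0, [:: j; 4 + i]));
            ([:: 4 + i; 4 + j], (0, [:: 4 + j; 4 + i]))]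
    | i <- D4nodes, j <- D4nodes].

(* The letters 0, 1, 2, 3 stand for r_0, r_1, e_0, e_1. *)
Definition G2rels : seq relation :=
  [:: ([:: 0; 0], (0, [::])); ([:: 1; 1], (0, [::]));
      ([:: 0; 2], (0, [:: 2])); ([:: 2; 0], (0, [:: 2]));
      ([:: 1; 3], (0, [:: 3])); ([:: 3; 1], (0, [:: 3]));
      ([:: 2; 2], (3, [:: 2])); ([:: 3; 3], (1, [:: 3]));
      ([:: 0; 3; 2], (0, [:: 1; 2])); ([:: 2; 3; 0], (0, [:: 2; 1]));
      ([:: 3; 0; 3; 0; 3], (0, [:: 3])); ([:: 3; 0; 3; 0; 1], (0, [:: 3; 0; 1; 0]));
      ([:: 2; 1; 2], (2, [:: 2])); ([:: 1; 0; 3; 0; 3], (0, [:: 0; 1; 0; 3]));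
      ([:: 1; 0; 1; 0; 1; 0; 1; 0; 1; 0; 1; 0], (0, [::]))].

Definition D4cert : seq (word * word) := Eval vm_compute in completion D4rels.
Definition G2cert : seq (word * word) := Eval vm_compute in completion G2rels.
Definition D4trie : trie := Eval vm_compute in replay D4rels D4cert.
Definition G2trie : trie := Eval vm_compute in replay G2rels G2cert.
Lemma D4trieE : D4trie = replay D4rels D4cert. Proof. by vm_compute. Qed.
Lemma G2trieE : G2trie = replay G2rels G2cert. Proof. by vm_compute. Qed.

(** * Irreducible words and the multiplication table of Br(D4) *)

Fixpoint irreducibles (n : nat) (t : trie) (gens : seq nat) (ws : seq word) : seq word :=
  if n is n'.+1 then
    ws ++ irreducibles n' t gens
      [seq v <- [seq rcons w g | w <- ws, g <- gens] | eqw (norm t v).2 v]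
  else [::].

Definition G2words : seq word := Eval vm_compute in irreducibles 20 G2trie (iota 0 4) [:: [::]].
Definition D4words : seq word := Eval vm_compute in irreducibles 20 D4trie (iota 1 8) [:: [::]].

(* An irreducible word [w] with the list of the pairs [(k, p)] such that [w g]
   reduces to [d^k] times word number [p], indexed by the letter [g]; words are
   numbered from 1, which is the empty word, and letter 0 is not used. *)
Definition state := (word * seq (nat * positive))%type.

(** A missing word gets the number following the last one, which [D4valid] rejects; [D4edge_valid]
    thus certifies that no product leaves the list. *)
Fixpoint indexw (w : word) (ws : seq word) (p : positive) : positive :=
  if ws is v :: ws' then if eqw w v then p else indexw w ws' (Pos.succ p) else p.

Definition D4table : PositiveMap.t state := Eval vm_compute in
  (foldl (fun s w =>
    (PositiveMap.add s.2
       (w, (0, xH) :: [seq (let: (k, v) := norm D4trie (rcons w g) in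
                            (k, indexw v D4words xH)) | g <- iota 1 8]) s.1,
     Pos.succ s.2)) (PositiveMap.empty state, xH) D4words).1.

Definition D4state (p : positive) : state :=
  if PositiveMap.find p D4table is Some s then s else ([::], [::]).
Definition D4word (p : positive) : word := (D4state p).1.
Definition D4act (g : nat) (p : positive) : nat * positive :=
  nth (0, xH) (D4state p).2 g.
Definition D4valid (p : positive) := Pos.leb p 1569.

Fixpoint allpos (P : positive -> bool) (n : nat) (p : positive) : bool :=
  if n is n'.+1 then if P p then allpos P n' (Pos.succ p) else false else true.

Lemma allposP (P : positive -> bool) n p q : allpos P n p ->
  Pos.to_nat p <= Pos.to_nat q < Pos.to_nat p + n -> P q.
Proof.
elim: n p => [|n IHn] p /=; first by rewrite addn0 ltnNge => _ /andP[->].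
case: ifP => // Pp /IHn; rewrite Pos2Nat.inj_succ addSnnS => IH.
rewrite leq_eqVlt => /andP[/predU1P[/Pos2Nat.inj<- //|lt_pq] ltq].
by apply: IH; rewrite lt_pq.
Qed.

Lemma D4validE p : D4valid p = (Pos.to_nat p <= 1569).
Proof.
have <- : Pos.to_nat 1569 = 1569 by vm_compute.
apply/idP/idP; first by move/Pos.leb_le/Pos2Nat.inj_le/leP.
by move/leP/Pos2Nat.inj_le/Pos.leb_le.
Qed.

Lemma D4allP (P : positive -> bool) : allpos P 1569 xH ->
  forall p, D4valid p -> P p.
Proof.
move=> allP p; rewrite D4validE => vp; apply: (allposP allP).
by rewrite (_ : Pos.to_nat 1 = 1) // add1n ltnS vp andbT; apply/leP/Pos2Nat.is_pos.
Qed.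

Definition eqkp (x y : nat * positive) := eqn x.1 y.1 && Pos.eqb x.2 y.2.

Lemma eqkpP x y : eqkp x y -> x = y.
Proof. by case: x y => [k p] [l q] /andP[/= /eqnP-> /Pos.eqb_eq->]. Qed.

Lemma eqwP u v : reflect (u = v) (eqw u v).
Proof.
elim: u v => [|a u IHu] [|b v] /=; try by constructor.
by apply: (iffP andP) => [[/eqnP-> /IHu->]|[<- <-]] //; split; [apply/eqnP|apply/IHu].
Qed.

(** * Finite checks by computation *)

Lemma D4edge_correct : allpos (fun p =>
  all (fun g => let: (k, q) := D4act g p in
                let: (l, v) := rewr 300 D4trie 0 (rev (D4word p)) [:: g] in
                eqn k l && eqw v (D4word q)) (iota 1 8)) 1569 xH.
Proof. by vm_compute. Qed.

Lemma D4edge_valid : allpos (fun p => all (fun e => D4valid e.2) (D4state p).2) 1569 xH.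
Proof. by vm_compute. Qed.

(** This makes the monomial matrices of the table a model of Br(D4). *)
Lemma D4table_rels : allpos (fun p => all (fun e : relation =>
  let: (u, (k, v)) := e in eqkp (run D4act u 0 p) (run D4act v k p)) D4rels) 1569 xH.
Proof. by vm_compute. Qed.

(** Distinct irreducible words are therefore separated by the first row of their matrices. *)
Lemma D4table_words : allpos (fun p => eqkp (run D4act (D4word p) 0 xH) (0, p)) 1569 xH.
Proof. by vm_compute. Qed.

Definition D4letter (a : nat) := (0 < a) && (a <= 8).

Lemma D4table_letters : allpos (fun p => all D4letter (D4word p)) 1569 xH.
Proof. by vm_compute. Qed.

Definition G2image (w : word) : word :=
  flatten [seq nth [::] [:: [:: 1; 2; 4]; [:: 3]; [:: 5; 6; 8]; [:: 7]] a | a <- w].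

Definition G2state (w : word) : positive := (run D4act (G2image w) 0 xH).2.

Definition sigma_letter (a : nat) := if a <= 4 then sigmaD4 a else 4 + sigmaD4 (a - 4).

(** The enumeration behind surjectivity. Only states are compared, since powers of [d] are units and
    go into the coefficient. *)
Lemma D4fixed_states : allpos (fun p =>
  Pos.eqb (run D4act (map sigma_letter (D4word p)) 0 xH).2 p ==>
  has (fun w => Pos.eqb p (G2state w)) G2words) 1569 xH.
Proof. by vm_compute. Qed.

(** Runs from the empty word are enough: by [D4ev] such a run determines the element of Br(D4). *)
Lemma G2image_rels : all (fun e : relation => let: (u, (k, v)) := e in
  eqkp (run D4act (G2image u) 0 xH) (run D4act (G2image v) k xH)) G2rels.
Proof. by vm_compute. Qed.

Lemma G2rel_letters : all (fun e : relation =>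
  all (gtn 4) e.1 && all (gtn 4) e.2.2) G2rels.
Proof. by vm_compute. Qed.

Lemma G2word_letters : all (all (gtn 4)) G2words.
Proof. by vm_compute. Qed.

Lemma G2words_closed : all (fun w => all (fun g =>
  has (eqw (norm G2trie (rcons w g)).2) G2words) (iota 0 4)) G2words.
Proof. by vm_compute. Qed.

Lemma size_G2words : size G2words = 39. Proof. by []. Qed.

Lemma G2states_distinct : all (fun i => all (fun j =>
  Pos.eqb (G2state (nth [::] G2words i)) (G2state (nth [::] G2words j)) ==> (eqn i j))
  (iota 0 39)) (iota 0 39).
Proof. by vm_compute. Qed.

Local Open Scope ring_scope.

(** * Soundness of rewriting in an algebra *)

Section Evaluation.
Variables (L : comUnitRingType) (d : L) (A : algType L) (gen : nat -> A).

Definition ev (w : word) : A := \prod_(a <- w) gen a.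

Lemma ev_nil : ev [::] = 1. Proof. by rewrite /ev big_nil. Qed.
Lemma ev_cons a w : ev (a :: w) = gen a * ev w. Proof. by rewrite /ev big_cons. Qed.
Lemma ev_cat u v : ev (u ++ v) = ev u * ev v. Proof. by rewrite /ev big_cat. Qed.

Definition holds (e : relation) := ev e.1 = d ^+ e.2.1 *: ev e.2.2.

Definition sound (t : trie) := forall s k r s',
  tfind t s = Some ((k, r), s') -> ev (rev s) = d ^+ k *: ev (rev s' ++ r).

Lemma tfind_insert l r t s x : tfind (tinsert l r t) s = Some x ->
  tfind t s = Some x \/ exists2 s', s = l ++ s' & x = (r, s').
Proof.
elim: l t s => [|a l IHl] [o ch] s.
  by case: s => [|b s] /= [<-]; right; [exists [::]|exists (b :: s)].
case: s => [|b s] /=; case: o => [?|] //; try by left.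
rewrite nth_set_nth /=; case: eqP => [->|_]; last by left.
by move=> /IHl[|[s' -> ->]]; [left|right; exists s'].
Qed.

Lemma sound_insert t l r : sound t -> holds (l, r) -> sound (tinsert (rev l) r t).
Proof.
move=> t_ok lr s k v s' /tfind_insert[/t_ok//|[s0 -> [rE ->]]].
by move: lr; rewrite -rE /holds rev_cat revK !ev_cat /= => ->; rewrite scalerAr.
Qed.

Lemma sound0 : sound trie0.
Proof.
have tfind0 s : tfind trie0 s = None by elim: s => //= a s; rewrite nth_nil.
by move=> s k r s'; rewrite tfind0.
Qed.

Lemma rewr_sound t n k s w : sound t ->
  d ^+ k *: ev (catrev s w) =
  d ^+ (rewr n t k s w).1 *: ev (rewr n t k s w).2.
Proof.
move=> t_ok; elim: n k s w => [|n IHn] k s [|a w] //.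
have -> : rewr n.+1 t k s (a :: w) =
    if tfind t (a :: s) is Some ((k', r), s') then rewr n t (k' + k) s' (r ++ w)
    else rewr n t k (a :: s) w by [].
case E: (tfind t (a :: s)) => [[[k' r] s']|]; rewrite -IHn //.
have := t_ok _ _ _ _ E; rewrite !catrevE !ev_cat rev_cons -cats1 !ev_cat => srE.
(* Writing [gen a] as [ev [:: a]] exposes the product that [srE] rewrites. *)
rewrite ev_cons mulrA -[gen a]mulr1 -ev_nil -ev_cons srE mulrA.
by rewrite -scalerAl scalerA -exprD addnC.
Qed.

Lemma norm_sound t w : sound t -> ev w = d ^+ (norm t w).1 *: ev (norm t w).2.
Proof. by move=> t_ok; rewrite -(rewr_sound _ 0 [::] w t_ok) scale1r. Qed.

Hypothesis d_unit : d \is a GRing.unit.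

Lemma scale_expr_inj k : injective (fun x : A => d ^+ k *: x).
Proof. by apply: can_inj (fun x => d ^- k *: x) _ => x; rewrite scalerA mulVr ?unitrX ?scale1r. Qed.

(** The rule and the equation differ by the smaller of the two powers of [d], which cancels because
    [d] is a unit. *)
Lemma orient_holds x y e : d ^+ x.1 *: ev x.2 = d ^+ y.1 *: ev y.2 ->
  orient x y = Some e -> holds e.
Proof.
case: x y => [k u] [l v] /= uv; case: eqwP => // _.
case: ifP => _; case: ifP => // le_kl [<-];
  apply: (@scale_expr_inj (minn k l)); rewrite /= scalerA -exprD.
  by rewrite (minn_idPl _) // subnKC.
by rewrite (minn_idPr _) // subnKC.
Qed.

Lemma sound_add_rule t o : sound t -> (forall e, o = Some e -> holds e) ->
  sound (add_rule t o).
Proof. by case: o => [[l r]|] //= t_ok /(_ _ erefl); apply: sound_insert. Qed.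

Lemma of_relation_holds t e e' : sound t -> holds e ->
  of_relation t e = Some e' -> holds e'.
Proof.
case: e => [u [k v]] t_ok; rewrite /holds /= (norm_sound u t_ok) (norm_sound v t_ok).
case: (norm t v) => l v' /= uv; apply: orient_holds.
by rewrite uv scalerA -exprD.
Qed.

Lemma superpose_holds t xy e : sound t -> superpose t xy = Some e -> holds e.
Proof.
case: xy => x y t_ok /=.
have := norm_sound y t_ok; case: (norm t y) => k y' /= yE.
have := norm_sound (x ++ y') t_ok; case: (norm t (x ++ y')) => l v /= vE.
apply: orient_holds; rewrite -(norm_sound _ t_ok) /= ev_cat yE.
by rewrite -scalerAr -ev_cat vE scalerA exprD.
Qed.

Lemma replay_sound rels cert : (forall e, e \in rels -> holds e) ->
  sound (replay rels cert).
Proof.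
move=> rels_ok; rewrite /replay.
have: sound (foldl (fun t e => add_rule t (of_relation t e)) trie0 rels).
  elim: rels trie0 sound0 rels_ok => //= e rels IH t t_ok rels_ok.
  apply: IH => [|e' e'in]; last by apply: rels_ok; rewrite inE e'in orbT.
  apply: sound_add_rule => // e'; apply: of_relation_holds => //.
  by apply: rels_ok; rewrite mem_head.
elim: cert (foldl _ _ _) => //= xy cert IH t t_ok; apply: IH.
by apply: sound_add_rule => // e; apply: superpose_holds.
Qed.
End Evaluation.

(** * Br(G2) is generated by its four generators *)

Section Subalgebra.
Variables (L : comUnitRingType) (A : algType L) (S : A -> Prop).
Hypotheses (S1 : S 1) (SZD : forall a x y, S x -> S y -> S (a *: x + y)).
Hypothesis SM : forall x y, S x -> S y -> S (x * y).

Let P : {pred A} := fun x => `[< S x >].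

Let P_closed : GRing.subalg_closed P.
Proof.
split=> [|a x y /asboolP Sx /asboolP Sy|x y /asboolP Sx /asboolP Sy];
  apply/asboolP; by [|apply: SZD|apply: SM].
Qed.

HB.instance Definition _ := GRing.isSubalgClosed.Build L A P P_closed.

Record subalgebra := SubAlgebra { subalgebra_val :> A; _ : subalgebra_val \in P }.
HB.instance Definition _ := [isSub for subalgebra_val].
HB.instance Definition _ := [Choice of subalgebra by <:].
HB.instance Definition _ := [SubChoice_isSubAlgebra of subalgebra by <:].

Let inclusion : subalgebra -> A := val.
HB.instance Definition _ := GRing.RMorphism.on inclusion.
HB.instance Definition _ := GRing.Linear.on inclusion.

(* Uniqueness alone makes the subalgebra epimorphic in [A]; mapping [A] into the
   subalgebra by existence makes it all of [A]. *)
Lemma BrG2_generated (d : L) (r0 r1 e0 e1 : A) :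
  is_BrG2 d r0 r1 e0 e1 -> S r0 -> S r1 -> S e0 -> S e1 -> forall x, S x.
Proof.
move=> [rel univ] /asboolP S0 /asboolP S1' /asboolP Se0 /asboolP Se1 x.
pose s0 := SubAlgebra S0; pose s1 := SubAlgebra S1'.
pose f0 := SubAlgebra Se0; pose f1 := SubAlgebra Se1.
have srel : BrG2_rel d s0 s1 f0 f1.
  case: rel => -[? ? ? ? ?] [? ? ? ? ?] [? ? ? ? ?].
  have XE (y : subalgebra) n : val (y ^+ n) = val y ^+ n by rewrite rmorphXn.
  do !split; apply/val_inj; rewrite /= ?XE //=.
have [[phi [p0 p1 p2 p3]] _] := univ _ _ _ _ _ srel.
have [_ uniq] := univ _ _ _ _ _ rel.
have /= <- := uniq (inclusion \o phi) idfun _ _ _ _ x.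
- exact/asboolP/(valP (phi x)).
- by rewrite /= p0.
- by rewrite /= p1.
- by rewrite /= p2.
- by rewrite /= p3.
Qed.
End Subalgebra.

(** * Monomial matrices and the regular representation *)

Section MonomialMatrices.
Variables (L : comUnitRingType) (d : L) (n : nat).
Variable act : nat -> 'I_n.+1 -> nat * 'I_n.+1.

(** The matrices act on row vectors from the right, so a matrix product follows the letters of a
    word in reading order. *)
Definition monomial_mx (g : nat) : 'M[L]_n.+1 :=
  \matrix_(i < n.+1) (d ^+ (act g i).1 *: delta_mx 0 (act g i).2).

Lemma row_ev_monomial u k i : d ^+ k *: row i (ev monomial_mx u) =
  d ^+ (run act u k i).1 *: delta_mx 0 (run act u k i).2.
Proof.
elim: u k i => [|g u IHu] k i /=; first by rewrite ev_nil row1.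
rewrite ev_cons; case E: (act g i) => [l j].
rewrite -IHu (row_mul i (monomial_mx g)) rowK E /= -scalemxAl -rowE scalerA.
by rewrite -exprD addnC.
Qed.

Lemma monomial_holds e :
  (forall i, run act e.1 0 i = run act e.2.2 e.2.1 i) -> holds d monomial_mx e.
Proof.
move=> uv; apply/row_matrixP => i.
by rewrite linearZ /= row_ev_monomial -uv -row_ev_monomial expr0 scale1r.
Qed.
End MonomialMatrices.

(* States are numbered in binary for the computations; here they become row
   indices. *)
Section PositiveStates.
Variables (n : nat) (act : nat -> positive -> nat * positive).
Let valid p := (Pos.to_nat p <= n.+1)%N.
Hypothesis act_valid : forall g p, valid p -> valid (act g p).2.

(** States are numbered from 1 and ordinals from 0; the default value of [inord] is never met on
    valid states. *)
Let to_ord p : 'I_n.+1 := inord (Pos.to_nat p).-1.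
Let of_ord (i : 'I_n.+1) := Pos.of_succ_nat i.
Let act_ord g i := let: (k, q) := act g (of_ord i) in (k, to_ord q).

Let to_ordK p : valid p -> of_ord (to_ord p) = p.
Proof.
move=> vp; have p_gt0 : (0 < Pos.to_nat p)%N by apply/leP/Pos2Nat.is_pos.
rewrite /of_ord inordK; last by rewrite prednK.
by apply: Pos2Nat.inj; rewrite SuccNat2Pos.id_succ prednK.
Qed.

Let of_ord_valid i : valid (of_ord i).
Proof. by rewrite /valid SuccNat2Pos.id_succ. Qed.

Let of_ordK i : to_ord (of_ord i) = i.
Proof. by rewrite /to_ord SuccNat2Pos.id_succ inord_val. Qed.

Let run_ord u k p : valid p -> run act_ord u k (to_ord p) =
  ((run act u k p).1, to_ord (run act u k p).2).
Proof.
elim: u k p => //= g u IHu k p vp; rewrite /act_ord to_ordK //.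
by have := act_valid g vp; case: (act g p) => l q; apply: IHu.
Qed.

(** The functional [f p] reads the matrix entry in the row of the empty word and the column of
    [p]. *)
Lemma regular_model (L : comUnitRingType) (d : L) (rels : seq relation) :
  (forall p e, valid p -> e \in rels -> run act e.1 0 p = run act e.2.2 e.2.1 p) ->
  exists (C : algType L) (gen : nat -> C),
    (forall e, e \in rels -> holds d gen e) /\
  exists f : positive -> C -> L, (forall p, scalar (f p)) /\
    forall u p, valid p -> f p (ev gen u) =
      if Pos.eqb (run act u 0 xH).2 p then d ^+ (run act u 0 xH).1 else 0.
Proof.
move=> rels_ok; exists 'M[L]_n.+1, (monomial_mx d act_ord); split=> [e ein|].
  apply: monomial_holds => i.
  by rewrite -(of_ordK i) !run_ord // rels_ok.
exists (fun p (M : 'M[L]_n.+1) => M (to_ord xH) (to_ord p)); split=> [p a M N|u p vp].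
  by rewrite !mxE.
have v1 : valid xH by [].
have := row_ev_monomial d act_ord u 0 (to_ord xH).
rewrite expr0 scale1r run_ord // => /rowP/(_ (to_ord p)).
rewrite !mxE /= => ->.
have -> : (to_ord p == to_ord (run act u 0 xH).2) = Pos.eqb (run act u 0 xH).2 p.
  apply/eqP/idP => [eq_ord|/Pos.eqb_eq-> //].
  by apply/Pos.eqb_eq; rewrite -(to_ordK (run_preserves act_valid u 0 v1)) -eq_ord to_ordK.
by case: Pos.eqb; rewrite ?mulr1 ?mulr0.
Qed.
End PositiveStates.

Lemma scalar0 (L : comUnitRingType) (A : lmodType L) (f : A -> L) :
  scalar f -> f 0 = 0.
Proof. by move=> /(_ (-1) 0 0); rewrite scaler0 addr0 mulN1r addNr. Qed.

Lemma scalar_sum (L : comUnitRingType) (A : lmodType L) (f : A -> L) n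
    (c : 'I_n -> L) (x : 'I_n -> A) : scalar f ->
  f (\sum_(i < n) c i *: x i) = \sum_(i < n) c i * f (x i).
Proof.
move=> fP; elim/big_rec2: _ => [|i s y _ <-]; last by rewrite fP.
exact: scalar0.
Qed.

(** * Br(D4): reduction of monomials and coordinates *)

Section BrD4.
Variables (L : comUnitRingType) (d : L).
Hypothesis d_unit : d \is a GRing.unit.

Definition D4gen (B : algType L) (R E : nat -> B) (a : nat) : B :=
  if (a <= 4)%N then R a else E (a - 4)%N.

Lemma D4genR (B : algType L) (R E : nat -> B) i :
  i \in D4nodes -> D4gen R E i = R i.
Proof. by rewrite !inE => /or4P[]/eqP->. Qed.

Lemma D4genE (B : algType L) (R E : nat -> B) i :
  i \in D4nodes -> D4gen R E (4 + i) = E i.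
Proof. by rewrite !inE => /or4P[]/eqP->. Qed.

Variant D4letter_spec (a : nat) : Prop :=
  | D4letterR i of i \in D4nodes & a = i
  | D4letterE i of i \in D4nodes & a = (4 + i)%N.

Lemma D4letterP a : D4letter a -> D4letter_spec a.
Proof.
by do 9?[case: a => [|a] //] => _;
  [exact: (@D4letterR _ 1)|exact: (@D4letterR _ 2)|exact: (@D4letterR _ 3)|
   exact: (@D4letterR _ 4)|exact: (@D4letterE _ 1)|exact: (@D4letterE _ 2)|
   exact: (@D4letterE _ 3)|exact: (@D4letterE _ 4)].
Qed.

Lemma BrD4_relP (B : algType L) (R E : nat -> B) :
  BrD4_rel d R E <-> (forall e, e \in D4rels -> holds d (D4gen R E) e).
Proof.
split=> [[rel1 [rel2 rel3]] e|rels_ok].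
  rewrite mem_cat => /orP[/flatten_mapP[i iD]|/flattenP[s /allpairsP[[i j]]]].
    have [? ? ? ?] := rel1 i iD.
    rewrite !inE => /or4P[]/eqP->; rewrite /holds /= !ev_cons ev_nil;
    by rewrite ?(D4genR _ _ iD) ?(D4genE _ _ iD) ?mulr1 ?expr0 ?expr1 ?scale1r.
  case=> /= iD jD ->; case: eqP => [_|/eqP ij]; first by rewrite in_nil.
  case: ifP => [adj|/negbT adj].
    have [RR RE RER] := rel3 i j iD jD adj.
    by rewrite !inE => /or3P[]/eqP->; rewrite /holds /= !ev_cons ev_nil;
      rewrite ?(D4genR _ _ iD) ?(D4genE _ _ iD) ?(D4genR _ _ jD) ?(D4genE _ _ jD) ?mulr1 ?expr0 ?expr1 ?scale1r ?mulrA.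
  have [? ? ?] := rel2 i j iD jD ij adj.
  by rewrite !inE => /or3P[]/eqP->; rewrite /holds /= !ev_cons ev_nil;
    rewrite ?(D4genR _ _ iD) ?(D4genE _ _ iD) ?(D4genR _ _ jD) ?(D4genE _ _ jD) ?mulr1 ?expr0 ?expr1 ?scale1r ?mulrA.
have rels1 i e : i \in D4nodes ->
    e \in [:: ([:: i; i], (0%N, [::])); ([:: 4 + i; 4 + i], (1%N, [:: 4 + i]));
       ([:: i; 4 + i], (0%N, [:: 4 + i])); ([:: 4 + i; i], (0%N, [:: 4 + i]))]%N ->
    holds d (D4gen R E) e.
  by move=> iD ei; apply: rels_ok; rewrite mem_cat; apply/orP; left;
     apply/flatten_mapP; exists i.
have rels2 i j e : i \in D4nodes -> j \in D4nodes -> i != j ->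
    e \in (if D4adj i j then
        [:: ([:: i; j; i], (0, [:: j; i; j])); ([:: j; i; 4 + j], (0, [:: 4 + i; 4 + j]));
            ([:: i; 4 + j; i], (0, [:: j; 4 + i; j]))]
      else [:: ([:: i; j], (0, [:: j; i])); ([:: 4 + i; j], (0, [:: j; 4 + i]));
            ([:: 4 + i; 4 + j], (0, [:: 4 + j; 4 + i]))])%N ->
    holds d (D4gen R E) e.
  move=> iD jD ij eij; apply: rels_ok; rewrite mem_cat; apply/orP; right.
  apply/flattenP; eexists; last exact: eij.
  by apply/allpairsP; exists (i, j); rewrite /= (negPf ij).
split=> [i iD|]; last split=> [i j iD jD ij adj|i j iD jD adj].
- have mem k (lt_k : (k < _)%N) := rels1 i _ iD (mem_nth ([::], (0%N, [::])) lt_k).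
  by split; [have := mem 0%N|have := mem 1%N|have := mem 2%N|have := mem 3%N];
    move=> /(_ isT); rewrite /holds /= !ev_cons ev_nil;
    rewrite ?(D4genR _ _ iD) ?(D4genE _ _ iD) ?mulr1 ?expr0 ?expr1 ?scale1r.
- have := rels2 i j _ iD jD ij; rewrite (negPf adj) => rij.
  have mem k (lt_k : (k < _)%N) := rij _ (mem_nth ([::], (0%N, [::])) lt_k).
  by split; [have := mem 0%N|have := mem 1%N|have := mem 2%N];
    move=> /(_ isT); rewrite /holds /= !ev_cons ev_nil;
    rewrite ?(D4genR _ _ iD) ?(D4genE _ _ iD) ?(D4genR _ _ jD) ?(D4genE _ _ jD) ?mulr1 ?expr0 ?expr1 ?scale1r.
have ij : i != j by apply: contraTneq adj => <-; move: iD; rewrite !inE => /or4P[]/eqP->.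
have := rels2 i j _ iD jD ij; rewrite adj => rij.
have mem k (lt_k : (k < _)%N) := rij _ (mem_nth ([::], (0%N, [::])) lt_k).
by split; [have := mem 0%N|have := mem 1%N|have := mem 2%N];
  move=> /(_ isT); rewrite /holds /= !ev_cons ev_nil;
  rewrite ?(D4genR _ _ iD) ?(D4genE _ _ iD) ?(D4genR _ _ jD) ?(D4genE _ _ jD) ?mulr1 ?expr0 ?expr1 ?scale1r ?mulrA.
Qed.

Lemma D4act_valid g p : D4valid p -> D4valid (D4act g p).2.
Proof.
move=> /(D4allP D4edge_valid)/(all_nthP (0%N, xH)) es_ok; rewrite /D4act.
case: (ltnP g (size (D4state p).2)) => [lt_g|le_g]; last by rewrite nth_default.
exact: es_ok.
Qed.

Lemma D4run_valid u k p : D4valid p -> D4valid (run D4act u k p).2.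
Proof. exact: (run_preserves D4act_valid). Qed.

Section Universal.
Variables (B : algType L) (R E : nat -> B).
Hypothesis BrD4 : is_BrD4 d R E.
Let evB := ev (D4gen R E).

(** By [D4edge_correct] each edge of the table is a reduction by a sound trie, so right
    multiplication in [B] follows the table. *)
Lemma D4run_ev u k p : all D4letter u -> D4valid p ->
  d ^+ k *: (evB (D4word p) * evB u) =
  d ^+ (run D4act u k p).1 *: evB (D4word (run D4act u k p).2).
Proof.
have t_ok : sound d (D4gen R E) D4trie.
  by rewrite D4trieE; apply: replay_sound => //; apply/BrD4_relP; case: BrD4.
elim: u k p => [|g u IHu] k p /=; first by rewrite /evB ev_nil mulr1.
move=> /andP[/andP[g_gt0 g_le8] u_ok] vp.
have /allP/(_ g) := D4allP D4edge_correct vp; rewrite mem_iota g_gt0 => /(_ g_le8).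
have := D4act_valid g vp; case: (D4act g p) => l q vq.
have := rewr_sound 300 0 (rev (D4word p)) [:: g] t_ok.
case: (rewr _ _ _ _ _) => l' v /= pgE /andP[/eqnP ll' /eqwP vE].
move: pgE; rewrite -ll' vE catrevE revK ev_cat expr0 scale1r => pgE.
rewrite -IHu // -/evB /evB ev_cons mulrA -[D4gen R E g]mulr1 -(ev_nil (D4gen R E)).
by rewrite -ev_cons pgE -scalerAl scalerA -exprD addnC.
Qed.

Lemma D4word1 : D4word xH = [::]. Proof. by []. Qed.

Lemma D4ev u k : all D4letter u ->
  d ^+ k *: evB u = d ^+ (run D4act u k xH).1 *: evB (D4word (run D4act u k xH).2).
Proof. by move=> u_ok; rewrite -D4run_ev // D4word1 /evB ev_nil mul1r. Qed.

(** The universal property maps [B] to the matrix model, and the coordinate functionals are pulled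
    back along this map. *)
Lemma D4coordinates : exists f : positive -> B -> L, (forall p, scalar (f p)) /\
  forall u p, all D4letter u -> D4valid p -> f p (evB u) =
      if Pos.eqb (run D4act u 0 xH).2 p then d ^+ (run D4act u 0 xH).1 else 0.
Proof.
have act_valid g p : (Pos.to_nat p <= 1569)%N -> (Pos.to_nat (D4act g p).2 <= 1569)%N.
  by rewrite -!D4validE; apply: D4act_valid.
have [|C [gen [gen_ok [f [f_lin fE]]]]] := @regular_model 1568 D4act act_valid L d D4rels.
  move=> p [u [k v]]; rewrite -D4validE => vp.
  by move=> /(allP (D4allP D4table_rels vp)) /eqkpP.
have genE : D4gen gen (fun i => gen (4 + i)%N) =1 gen.
  by move=> a; rewrite /D4gen; case: leqP => // /ltnW le4a; rewrite subnKC.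
have evE u : ev (D4gen gen (fun i => gen (4 + i)%N)) u = ev gen u.
  by apply: eq_bigr => a _; rewrite genE.
have [|[phi phiE] _] := BrD4.2 C gen (fun i => gen (4 + i)%N).
  by apply/BrD4_relP => e /gen_ok; rewrite /holds !evE.
exists (fun p x => f p (phi x)); split=> [p a x y|u p u_ok].
  by rewrite linearP f_lin.
rewrite D4validE => /fE <-; congr (f p _); rewrite /evB /ev rmorph_prod.
apply: eq_big_seq => a /(allP u_ok)/D4letterP[] i iD ->; have [phiR phiE'] := phiE i iD.
  by rewrite (D4genR _ _ iD).
by rewrite (D4genE _ _ iD).
Qed.
End Universal.
End BrD4.

(** * Br(G2): spanning by 39 words *)

Section BrG2.
Variables (L : comUnitRingType) (d : L).
Hypothesis d_unit : d \is a GRing.unit.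

Definition G2gen (A : algType L) (r0 r1 e0 e1 : A) (a : nat) : A :=
  nth 0 [:: r0; r1; e0; e1] a.

Lemma BrG2_relP (A : algType L) (r0 r1 e0 e1 : A) :
  BrG2_rel d r0 r1 e0 e1 <->
  (forall e, e \in G2rels -> holds d (G2gen r0 r1 e0 e1) e).
Proof.
have exp6 : (r1 * r0) ^+ 6 = r1 * r0 * r1 * r0 * r1 * r0 * r1 * r0 * r1 * r0 * r1 * r0.
  by rewrite !exprS expr0 mulr1 !mulrA.
split=> [[[? ? ? ? ?] [? ? ? ? ?] [? ? ? ? rel6]] e|rels_ok].
  rewrite exp6 in rel6.
  by rewrite !inE; do 14?[case/orP]; move=> /eqP->;
    rewrite /holds /= !ev_cons ev_nil /= ?expr0 ?mulr1 ?expr0 ?expr1 ?scale1r ?mulrA.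
have rel k : (k < 15)%N -> holds d (G2gen r0 r1 e0 e1) (nth ([::], (0%N, [::])) G2rels k).
  by move=> lt_k; apply/rels_ok/mem_nth.
rewrite /BrG2_rel exp6; split; split;
  [have := rel 0%N isT|have := rel 1%N isT|have := rel 2%N isT|have := rel 3%N isT
  |have := rel 4%N isT|have := rel 5%N isT|have := rel 6%N isT|have := rel 7%N isT
  |have := rel 8%N isT|have := rel 9%N isT|have := rel 10%N isT|have := rel 11%N isT
  |have := rel 12%N isT|have := rel 13%N isT|have := rel 14%N isT];
  by rewrite /holds /= !ev_cons ev_nil /= ?expr0 ?mulr1 ?expr0 ?expr1 ?scale1r ?mulrA.
Qed.

Section Span.
Variables (A : algType L) (r0 r1 e0 e1 : A).
Hypothesis BrG2 : is_BrG2 d r0 r1 e0 e1.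
Let evA := ev (G2gen r0 r1 e0 e1).

(** Induction on the last letter, which [G2words_closed] absorbs. *)
Lemma G2ev u : all (gtn 4) u ->
  exists k, exists2 w, w \in G2words & evA u = d ^+ k *: evA w.
Proof.
have t_ok : sound d (G2gen r0 r1 e0 e1) G2trie.
  by rewrite G2trieE; apply: replay_sound => //; apply/BrG2_relP; case: BrG2.
elim/last_ind: u => [_|u g IHu].
  by exists 0%N, [::] => //; rewrite scale1r.
rewrite all_rcons => /andP[g4 /IHu[k [w w_in uE]]].
have /allP/(_ g) := allP G2words_closed w w_in.
rewrite mem_iota => /(_ g4)/hasP[v v_in /eqwP vE].
exists (k + (norm G2trie (rcons w g)).1)%N, v => //.
have := norm_sound (rcons w g) t_ok; rewrite vE exprD -scalerA /evA => <-.
by rewrite -!cats1 !ev_cat -/evA uE -scalerAl.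
Qed.

Definition G2basis (i : 'I_39) : A := evA (nth [::] G2words i).

(** The span contains 1 and the generators, and it is closed under products because by [G2ev] the
    product of two basis words is a multiple of a third; [BrG2_generated] then makes it
    everything. *)
Lemma BrG2_span x : exists c : 'I_39 -> L, x = \sum_(i < 39) c i *: G2basis i.
Proof.
pose S (y : A) := exists c : 'I_39 -> L, y = \sum_(i < 39) c i *: G2basis i.
have SZD a y z : S y -> S z -> S (a *: y + z).
  move=> [c ->] [c' ->]; exists (fun i => a * c i + c' i).
  rewrite scaler_sumr -big_split; apply: eq_bigr => i _.
  by rewrite scalerA scalerDl.
have S0 : S 0 by exists (fun=> 0); rewrite big1 // => i _; rewrite scale0r.
have SZ a y : S y -> S (a *: y) by move=> Sy; rewrite -[_ *: _]addr0; apply: SZD.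
have SD y z : S y -> S z -> S (y + z) by rewrite -{2}[y]scale1r; apply: SZD.
have Sev u : all (gtn 4) u -> S (evA u).
  move=> /G2ev[k [w w_in ->]]; apply: SZ.
  have lt_w : (index w G2words < 39)%N by rewrite -size_G2words index_mem.
  exists (fun i => (i == Ordinal lt_w)%:R).
  rewrite (bigD1 (Ordinal lt_w)) //= eqxx scale1r big1 => [|i /negPf->].
    by rewrite addr0 /G2basis nth_index.
  by rewrite scale0r.
have Sgen a : (a < 4)%N -> S (G2gen r0 r1 e0 e1 a).
  move=> a4; have := Sev [:: a]; rewrite /evA ev_cons ev_nil mulr1.
  by apply; rewrite /= a4.
have G2letters (i : 'I_39) : all (gtn 4) (nth [::] G2words i).
  by apply: (allP G2word_letters); rewrite mem_nth // size_G2words.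
apply: (@BrG2_generated L A S _ SZD _ d r0 r1 e0 e1) => //.
- by have := Sev [::] isT; rewrite /evA ev_nil.
- move=> y z [c ->] [c' ->]; rewrite mulr_suml.
  apply: (big_ind S) => // i _; rewrite mulr_sumr.
  apply: (big_ind S) => // j _; rewrite -scalerAl -scalerAr.
  by apply/SZ/SZ; rewrite -ev_cat; apply: Sev; rewrite all_cat !G2letters.
- exact: (Sgen 0%N).
- exact: (Sgen 1%N).
- exact: (Sgen 2%N).
- exact: (Sgen 3%N).
Qed.
End Span.

(** * The image of Br(G2) in Br(D4) and the invariant monomials *)

Section Image.
Variables (B : algType L) (R E : nat -> B).
Hypothesis BrD4 : is_BrD4 d R E.
Let evB := ev (D4gen R E).
Let evG2 := ev (G2gen (R 1%N * R 2%N * R 4%N) (R 3%N) (E 1%N * E 2%N * E 4%N) (E 3%N)).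

Lemma G2image_letters u : all D4letter (G2image u).
Proof.
by elim: u => //= a u IHu; rewrite /G2image /= all_cat IHu andbT; do 5?case: a => [|a] //.
Qed.

Lemma ev_G2image u : all (gtn 4) u -> evG2 u = evB (G2image u).
Proof.
elim: u => [|a u IHu] /=; first by rewrite /evG2 /evB !ev_nil.
case/andP=> a4 /IHu {}IHu.
rewrite /evG2 ev_cons -/evG2 IHu /evB /G2image /= ev_cat; congr (_ * _).
by do 4?[case: a a4 => [|a] a4 //]; rewrite /= !ev_cons ev_nil mulr1 ?mulrA.
Qed.

Lemma BrG2_rel_image :
  BrG2_rel d (R 1%N * R 2%N * R 4%N) (R 3%N) (E 1%N * E 2%N * E 4%N) (E 3%N).
Proof.
apply/BrG2_relP => -[u [k v]] ein; rewrite /holds /= -/evG2.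
have /andP[u4 v4] := allP G2rel_letters _ ein.
rewrite !ev_G2image // -[evB _]scale1r -(expr0 d).
rewrite (D4ev d_unit BrD4 0) ?(D4ev d_unit BrD4 k) ?G2image_letters //.
by have /eqkpP-> := allP G2image_rels _ ein.
Qed.

(** The coordinate at the state of word [i] kills all other terms by [G2states_distinct] and leaves
    [c i] times a power of the unit [d]. *)
Lemma G2image_free (c : 'I_39 -> L) :
  \sum_(i < 39) c i *: evB (G2image (nth [::] G2words i)) = 0 -> forall i, c i = 0.
Proof.
move=> c0 i; have [f [f_lin fE]] := D4coordinates BrD4.
pose w (j : 'I_39) := nth [::] G2words j.
have := scalar_sum c (fun j => evB (G2image (w j))) (f_lin (G2state (w i))).
rewrite {}c0 scalar0 // (bigD1 i) //= big1 => [|j ji].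
  rewrite addr0 fE ?G2image_letters ?D4run_valid // Pos.eqb_refl.
  move=> /esym c0; apply: (mulIr (unitrX (run D4act (G2image (w i)) 0 xH).1 d_unit)).
  by rewrite mul0r.
rewrite fE ?G2image_letters ?D4run_valid //; case eq_ij: Pos.eqb; rewrite ?mulr0 //.
have := allP G2states_distinct j; rewrite mem_iota => /(_ (ltn_ord j)) /allP/(_ i).
rewrite mem_iota => /(_ (ltn_ord i)); rewrite [Pos.eqb _ _]eq_ij /= => /eqnP/val_inj.
by move=> eq_ji; rewrite eq_ji eqxx in ji.
Qed.

Lemma inBrM_word x : inBrM d R E x ->
  exists a u, [/\ a \is a GRing.unit, all D4letter u & x = a *: evB u].
Proof.
elim=> [||| i iD| i iD|y z _ [a [u [aU u_ok ->]]] _ [b [v [bU v_ok ->]]]].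
- by exists 1, [::]; rewrite unitr1 /evB ev_nil scale1r.
- by exists d, [::]; rewrite d_unit /evB ev_nil.
- by exists d^-1, [::]; rewrite unitrV d_unit /evB ev_nil.
- exists 1, [:: i]; rewrite unitr1 /evB ev_cons ev_nil mulr1 scale1r D4genR //.
  by split=> //; move: iD; rewrite !inE => /or4P[]/eqP->.
- exists 1, [:: (4 + i)%N]; rewrite unitr1 /evB ev_cons ev_nil mulr1 scale1r D4genE //.
  by split=> //; move: iD; rewrite !inE => /or4P[]/eqP->.
exists (a * b), (u ++ v); rewrite unitrM aU bU all_cat u_ok v_ok /evB ev_cat.
by rewrite -scalerAl -scalerAr scalerA.
Qed.

Variable sigma : {lrmorphism B -> B}.
Hypothesis sigmaE : forall i, i \in D4nodes ->
  sigma (R i) = R (sigmaD4 i) /\ sigma (E i) = E (sigmaD4 i).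

Lemma sigma_node i : i \in D4nodes -> sigmaD4 i \in D4nodes.
Proof. by rewrite !inE => /or4P[]/eqP->. Qed.

Lemma sigma_ev u : all D4letter u -> sigma (evB u) = evB (map sigma_letter u).
Proof.
move=> u_ok; rewrite /evB /ev rmorph_prod big_map.
apply: eq_big_seq => a /(allP u_ok)/D4letterP[] i iD ->; have [sR sE] := sigmaE iD.
  have -> : sigma_letter i = sigmaD4 i by move: iD; rewrite !inE => /or4P[]/eqP->.
  by rewrite !D4genR ?sigma_node.
have -> : sigma_letter (4 + i) = (4 + sigmaD4 i)%N.
  by move: iD; rewrite !inE => /or4P[]/eqP->.
by rewrite !D4genE ?sigma_node.
Qed.

Lemma sigma_letters u : all D4letter u -> all D4letter (map sigma_letter u).
Proof.
move=> /allP u_ok; apply/allP => _ /mapP[a /u_ok/D4letterP[] i iD -> ->];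
by move: iD; rewrite !inE => /or4P[]/eqP->.
Qed.

(** Up to a unit, [x] is an irreducible word [p]. Its coordinate at [p] is 1, so the word moved by
    [sigma] must also reach [p], as otherwise 1 = 0 in [L]; [D4fixed_states] supplies the word of
    Br(G2). *)
Lemma sigma_fixed_BrM x : inBrM d R E x -> sigma x = x ->
  exists a, exists2 w, w \in G2words & x = a *: evB (G2image w).
Proof.
move=> /inBrM_word[a [u [aU u_ok ->]]].
have := D4ev d_unit BrD4 0 u_ok; rewrite expr0 scale1r => uE.
move: (run D4act u 0 xH) (D4run_valid u 0 (isT : D4valid xH)) uE => [k p] /= vp.
rewrite -/evB => ->; rewrite scalerA.
have {aU} : a * d ^+ k \is a GRing.unit by rewrite unitrM aU unitrX.
move: (a * _) => {}a aU.
have w_ok := D4allP D4table_letters vp.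
rewrite linearZ /= sigma_ev //.
set u' := map _ _; have u'_ok : all D4letter u' by apply: sigma_letters.
have /D4coordinates[f [f_lin fE]] := BrD4.
move=> /(congr1 (fun x => a^-1 *: x)); rewrite !scalerA mulVr // !scale1r => fixw.
have /eqkpP word_p := D4allP D4table_words vp.
have := congr1 (f p) fixw; rewrite !fE // word_p /= Pos.eqb_refl expr0.
case: ifP => [eq_p _|_ /eqP]; last by rewrite eq_sym oner_eq0.
have /implyP/(_ eq_p)/hasP[w w_in /Pos.eqb_eq pE] := D4allP D4fixed_states vp.
(* The negative power undoes the factor that arises when [G2image w] is reduced to word [p]. *)
exists (a * d ^- (run D4act (G2image w) 0 xH).1), w => //.
have := D4ev d_unit BrD4 0 (G2image_letters w); rewrite expr0 scale1r -/evB => ->.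
by rewrite -/(G2state w) -pE scalerA mulrVK ?unitrX.
Qed.
End Image.
End BrG2.

(** * The isomorphism and the two bases *)

Theorem theorem6p1
  (L : comUnitRingType) (d : L) (HL : laurent_ring d)
  (A : algType L) (r0 r1 e0 e1 : A) (HA : is_BrG2 d r0 r1 e0 e1)
  (B : algType L) (R E : nat -> B) (HB : is_BrD4 d R E)
  (sigma : {lrmorphism B -> B}) (Hsigma_bij : bijective sigma)
  (Hsigma : forall i, i \in D4nodes ->
     sigma (R i) = R (sigmaD4 i) /\ sigma (E i) = E (sigmaD4 i)) :
  (exists phi : {lrmorphism A -> B},
     [/\ [/\ phi r0 = R 1%N * R 2%N * R 4%N, phi r1 = R 3%N,
             phi e0 = E 1%N * E 2%N * E 4%N & phi e1 = E 3%N],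
         injective phi &
         forall y, inSBr d R E sigma y <-> exists x, phi x = y])
  /\
  (exists b : 'I_39 -> A,
     (forall x, exists c : 'I_39 -> L, x = \sum_(i < 39) c i *: b i) /\
     (forall c : 'I_39 -> L, \sum_(i < 39) c i *: b i = 0 -> forall i, c i = 0))
  /\
  (exists b : 'I_39 -> B,
     (forall i, inSBr d R E sigma (b i)) /\
     (forall y, inSBr d R E sigma y ->
        exists c : 'I_39 -> L, y = \sum_(i < 39) c i *: b i) /\
     (forall c : 'I_39 -> L, \sum_(i < 39) c i *: b i = 0 -> forall i, c i = 0)).
Proof.
have d_unit := HL.1.
have [[phi [phi0 phi1 phi2 phi3]] _] := HA.2 _ _ _ _ _ (BrG2_rel_image d_unit HB).
pose b := G2basis r0 r1 e0 e1; pose c39 := 'I_39 -> L.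
have phi_ev u : all (gtn 4) u ->
    phi (ev (G2gen r0 r1 e0 e1) u) = ev (D4gen R E) (G2image u).
  move=> u4; rewrite -(ev_G2image R E u4) /ev rmorph_prod.
  apply: eq_big_seq => a /(allP u4).
  by do 4?[case: a => [|a] //].
have word4 (i : 'I_39) : all (gtn 4) (nth [::] G2words i).
  by apply: (allP G2word_letters); rewrite mem_nth // size_G2words.
have phib i : phi (b i) = ev (D4gen R E) (G2image (nth [::] G2words i)).
  exact: phi_ev.
have phi_sum (c : c39) : phi (\sum_(i < 39) c i *: b i) = \sum_(i < 39) c i *: phi (b i).
  by rewrite linear_sum; apply: eq_bigr => i _; rewrite linearZ.
have free (c : c39) : \sum_(i < 39) c i *: phi (b i) = 0 -> forall i, c i = 0.
  move=> c0; apply: (G2image_free d_unit HB).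
  by rewrite -[RHS]c0; apply: eq_bigr => i _; rewrite phib.
have span x : exists c : c39, x = \sum_(i < 39) c i *: b i.
  exact: (BrG2_span d_unit HA).
(* Freeness of the images of the spanning words gives injectivity, and later also freeness of the
   words themselves. *)
have phi_ker x : phi x = 0 -> x = 0.
  have [c ->] := span x.
  rewrite phi_sum => /free c0; rewrite big1 // => i _.
  by rewrite c0 scale0r.
have phi_inj : injective phi by apply: raddf_inj phi_ker.
have [[_ [rel2 _]] _] := HB.
have SBr_gens a : (a < 4)%N -> inSBr d R E sigma (phi (G2gen r0 r1 e0 e1 a)).
  have rel12 := rel2 1%N 2%N isT isT isT isT.
  have rel14 := rel2 1%N 4%N isT isT isT isT.
  case: rel12 rel14 => [RR12 _ EE12] [RR14 _ EE14].
  do 4?[case: a => [|a] //] => _; rewrite /G2gen /= ?phi0 ?phi1 ?phi2 ?phi3;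
    apply: SBr_gen.
  - by apply: BrM_mul; [apply: BrM_mul|]; apply: BrM_R.
  (* Here [sigma] gives R_2 R_4 R_1, and commutation of the outer nodes restores the order. *)
  - rewrite !rmorphM /= !(Hsigma _ _).1 //= -mulrA -RR14 mulrA -RR12 //.
  - exact: BrM_R.
  - by rewrite (Hsigma _ _).1.
  - by apply: BrM_mul; [apply: BrM_mul|]; apply: BrM_E.
  - rewrite !rmorphM /= !(Hsigma _ _).2 //= -mulrA -EE14 mulrA -EE12 //.
  - exact: BrM_E.
  - by rewrite (Hsigma _ _).2.
have SBr_ev u : all (gtn 4) u ->
    inSBr d R E sigma (phi (ev (G2gen r0 r1 e0 e1) u)).
  elim: u => [_|a u IHu /= /andP[a4 /IHu]]; first by rewrite ev_nil rmorph1; apply: SBr_one.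
  by rewrite ev_cons rmorphM; apply: SBr_mul; apply: SBr_gens.
have SBr_basis i : inSBr d R E sigma (phi (b i)) by apply: SBr_ev.
have SBrP y : inSBr d R E sigma y <-> exists x, phi x = y.
  split=> [|[x <-]]; last first.
    have [c ->] := span x; rewrite phi_sum.
    by apply: big_ind => [||i _]; [apply: SBr_zero|apply: SBr_add|apply: SBr_scale].
  (* Invariant monomials lie in the image by [sigma_fixed_BrM]; the other cases hold since the image
     of [phi] is a subalgebra. *)
  elim=> [z zBrM zfix|||x1 x2 _ [y1 <-] _ [y2 <-]|a x1 _ [y1 <-]|x1 x2 _ [y1 <-] _ [y2 <-]].
  - have [a [w w_in ->]] := sigma_fixed_BrM d_unit HB Hsigma zBrM zfix.
    exists (a *: ev (G2gen r0 r1 e0 e1) w); rewrite linearZ /= phi_ev //.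
    exact: (allP G2word_letters).
  - by exists 0; rewrite rmorph0.
  - by exists 1; rewrite rmorph1.
  - by exists (y1 + y2); rewrite rmorphD.
  - by exists (a *: y1); rewrite linearZ.
  - by exists (y1 * y2); rewrite rmorphM.
split; first by exists phi.
split.
  exists b; split=> // c c0; apply: free.
  by rewrite -phi_sum c0 rmorph0.
exists (fun i => phi (b i)); split=> //; split=> // y /SBrP[x <-].
by have [c ->] := span x; exists c.
Qed.
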